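(* Let $1/2<p<1$ be fixed and $q=1-p$. Let $(N_k)_{k\ge1}$, $(m_k)_{k\ge1}$, $(c_k)_{k\ge1}$ be sequences of positive integers with $N_k\to\infty$, $m_k=N_kp$, $c_k/N_k^{1/2}\to1$, and $c_k\le m_k$, $c_k\le N_k-m_k$ for all $k$. Let $Y_k$ be a random variable with the maximum negative hypergeometric distribution with parameters $(N_k,m_k,c_k)$, and put $$\mu_k=\frac{c_k(p-q)}{q},\qquad \sigma_k=\frac{(c_kp)^{1/2}}{q}.$$ Then, as $k\to\infty$, $(Y_k-\mu_k)/\sigma_k$ converges in distribution to the standard normal distribution.
   Context: For a real number $z$ and integer $k\ge1$, $z^{(k)}=z(z-1)\cdots(z-k+1)$ is the falling factorial, and $z^{(0)}=1$. Maximum negative hypergeometric distribution with integer parameters $(N,m,c)$, where $1\le c\le m<N$ and $c\le N-m$: an urn contains $N$ balls, $m$ of one color and $N-m$ of another; balls are drawn without replacement until at least $c$ balls of both colors have been observed; $Y$ is the number of draws needed minus $2c$. Its probability mass function is $$\Pr[Y=y]=\binom{2c+y-1}{c-1}\,\frac{m^{(c+y)}(N-m)^{(c)}+m^{(c)}(N-m)^{(c+y)}}{N^{(2c+y)}},\qquad 0\le y\le\max\{m-c,\,N-m-c\},$$ and $\Pr[Y=y]=0$ for other $y$. *)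

(* Defs.v *)
From HB Require Import structures.
From mathcomp Require Import all_boot all_order all_algebra.
From mathcomp Require Import all_classical all_reals all_analysis.

Set Implicit Arguments.
Unset Strict Implicit.
Unset Printing Implicit Defensive.

Import Order.TTheory GRing.Theory Num.Theory.
Import numFieldNormedType.Exports.

Local Open Scope classical_set_scope.
Local Open Scope ring_scope.

(* Maximum negative hypergeometric distribution, for integer parameters with
   1 <= c <= m < N and c <= N - m: an urn contains N balls, m of one color and
   N - m of another; balls are drawn without replacement until at least c balls
   of both colors have been observed; the variable is the number of draws
   minus 2c. In that range of parameters none of the natural-number
   subtractions below is truncated. *)
Definition max_neg_hypergeometric_pmf (R : realType) (N m c y : nat) : R :=
  if (y <= maxn (m - c) (N - m - c))%N then
    'C(2 * c + y - 1, c - 1)%:R *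
    ((m ^_ (c + y))%:R * ((N - m) ^_ c)%:R +
     (m ^_ c)%:R * ((N - m) ^_ (c + y))%:R) / (N ^_ (2 * c + y))%:R
  else 0.

Definition has_max_neg_hypergeometric_distribution (R : realType)
    (d : measure_display) (T : measurableType d) (P : probability T R)
    (Y : {RV P >-> nat}) (N m c : nat) : Prop :=
  forall y : nat,
    P (Y @^-1` [set y]) = (max_neg_hypergeometric_pmf R N m c y)%:E.

Arguments has_max_neg_hypergeometric_distribution {R d T} P Y N m c.

Definition standardize (R : realType) (mu sigma : R) (n : nat) : R :=
  (n%:R - mu) / sigma.

Lemma measurable_standardize (R : realType) (mu sigma : R) :
  measurable_fun [set: nat] (standardize mu sigma).
Proof. by []. Qed.

HB.instance Definition _ (R : realType) (mu sigma : R) :=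
  isMeasurableFun.Build _ _ _ _ (standardize mu sigma)
    (measurable_standardize mu sigma).

(* The random variables X k may live on different probability spaces; the
   limit is given by its law nu, and the distribution functions are required
   to converge at every continuity point of the limiting one. *)
Definition cvg_in_distribution (R : realType) (d : nat -> measure_display)
    (T : forall k, measurableType (d k)) (P : forall k, probability (T k) R)
    (X : forall k, {RV (P k) >-> R}) (nu : probability (measurableTypeR R) R) : Prop :=
  forall x : R, {for x, continuous (fun t : R => nu `]-oo, t]%classic)} ->
    cdf (X k) x @[k --> \oo] --> nu `]-oo, x]%classic.

Arguments cvg_in_distribution {R d T} P X nu.

(* Main.v *)
Require Import Defs.
From HB Require Import structures.
From mathcomp Require Import all_boot all_order all_algebra.
From mathcomp Require Import all_classical all_reals all_analysis.
From mathcomp Require Import measurable_realfun.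
From mathcomp Require Import zify ring lra.

Set Implicit Arguments.
Unset Strict Implicit.
Unset Printing Implicit Defensive.

Import Order.TTheory GRing.Theory Num.Theory.
Import numFieldNormedType.Exports.

Local Open Scope classical_set_scope.
Local Open Scope ring_scope.

(** Let [a y] be the part of the mass at [y] contributed by the draws that end
    with the [c]-th ball of the minority colour: the negative hypergeometric
    weight of seeing [c + y] majority balls before it. The other part of the
    mass is at most [(q / p) ^ y] times [a y]; it never exceeds [a y], and it is
    negligible where [y] is large, in particular around [mu], which is of
    order [c]. So it is enough to understand [a].

    Stirling's formula is avoided by looking at ratios only. An explicit
    computation shows that, with [t = (y - mu) / sigma],
      [a (y + 1) / a y = 1 - t / sigma + O(1 / sigma ^ 2)]
    uniformly for [t] in a bounded window
    ([negative_hypergeometric_ratio_expansion]); the hypothesis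
    [c ~ sqrt N] enters here, since sampling without replacement only perturbs
    the ratio by [O(sigma / N)]. This is the discrete form of the equation
    [phi' = - t phi] of the normal density. Multiplying such ratios across the
    [O(sigma)] points of the window, [a y] is, up to a factor close to 1,
    a constant times the normal probability of the cell between the
    standardized values of [y] and [y + 1] ([gaussian_ratio_profile]). Summing
    over cells telescopes the normal distribution function.

    The unknown constant is eliminated by comparing with the whole window,
    once the window is known to carry almost all the mass. That tightness comes
    from log-concavity of [a] ([minority_last_pmf_log_concave]): past a point at
    standardized distance [M] from 0 the sequence decays geometrically
    with ratio about [1 - M / sigma], so its tail is at most about
    [sigma / M] times its value there, while the monotonicity of [a] between
    that point and the mode, together with total mass at most 1, bounds
    this value by about [1 / (sigma M)]. The tail is therefore
    [O(1 / M ^ 2)] ([log_concave_gaussian_tails]).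

    [discrete_normal_limit] packages this argument for laws on the natural
    numbers that are comparable to a log-concave sequence with such ratios, and
    the theorem is its instance for the maximum negative hypergeometric
    laws. *)

(** * The standard normal distribution function *)

Definition std_normal_cdf (R : realType) (x : R) : R :=
  fine (normal_prob 0 1 `]-oo, x]%classic).

Section std_normal.
Context {R : realType}.
Implicit Types (a b t x lo hi : R).
Local Notation phi := (@normal_pdf R 0 1).
Local Notation Phi := (@std_normal_cdf R).

Lemma std_normal_pdfE t : phi t = normal_peak 1 * expR (- (t ^+ 2 / 2)).
Proof.
by rewrite normal_pdfE ?oner_neq0// /normal_fun subr0 expr1n mulNr.
Qed.

Lemma std_normal_pdf_gt0 t : 0 < phi t.
Proof.
by rewrite std_normal_pdfE mulr_gt0 ?expR_gt0// normal_peak_gt0 ?oner_neq0.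
Qed.

Lemma EFin_std_normal_cdf x :
  normal_prob 0 1 `]-oo, x]%classic = (Phi x)%:E.
Proof. by rewrite /std_normal_cdf fineK// fin_num_measure. Qed.

Lemma std_normal_cdf_ge0 x : 0 <= Phi x.
Proof. exact: fine_ge0. Qed.

Lemma std_normal_cdf_le1 x : Phi x <= 1.
Proof.
by rewrite -lee_fin -EFin_std_normal_cdf probability_le1.
Qed.

Lemma std_normal_cdf_increment a b : a <= b ->
  (Phi b - Phi a)%:E = (\int[lebesgue_measure]_(t in `]a, b]) (phi t)%:E)%E.
Proof.
move=> ab; rewrite -[RHS]/(normal_prob 0 1 `]a, b]%classic) EFinB.
have : normal_prob 0 1 `]-oo, b]%classic =
    (normal_prob 0 1 `]-oo, a]%classic + normal_prob 0 1 `]a, b]%classic)%E.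
  rewrite (@itv_bndbnd_setU _ _ _ (BRight a))//; apply: measureU => //.
  by apply/seteqP; split=> x //= []; rewrite !in_itv/= => xa /andP[]; lra.
by rewrite !EFin_std_normal_cdf => ->; rewrite addeAC subee// add0e.
Qed.

Let integral_itv_cst a b (r : R) : a <= b ->
  (\int[lebesgue_measure]_(t in `]a, b]) (cst r%:E t))%E = (r * (b - a))%:E.
Proof.
move=> ab; rewrite integral_cst//= lebesgue_measure_itv/= lte_fin.
case: ltP => ba; first by rewrite -EFinB -EFinM.
have -> : b = a by lra.
by rewrite subrr mulr0 mule0.
Qed.

Lemma std_normal_cdf_increment_ge a b lo : a <= b -> 0 <= lo ->
  (forall t, a <= t <= b -> lo <= phi t) -> lo * (b - a) <= Phi b - Phi a.
Proof.
move=> ab lo0 lophi; rewrite -lee_fin std_normal_cdf_increment//.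
rewrite -integral_itv_cst//.
apply: ge0_le_integral => //.
  apply/measurable_EFinP; apply: measurable_funTS; exact: measurable_normal_pdf.
move=> t /=; rewrite in_itv/= => /andP[at_ tb]; rewrite lee_fin lophi//.
by rewrite ltW.
Qed.

Lemma std_normal_cdf_increment_le a b hi : a <= b ->
  (forall t, a <= t <= b -> phi t <= hi) -> Phi b - Phi a <= hi * (b - a).
Proof.
move=> ab phihi; rewrite -lee_fin std_normal_cdf_increment//.
rewrite -integral_itv_cst//.
apply: ge0_le_integral => //.
- by move=> t _; rewrite lee_fin normal_pdf_ge0.
- apply: measurable_funTS; apply: measurableT_comp => //.
  exact: measurable_normal_pdf.
- move=> t /=; rewrite in_itv/= => /andP[at_ tb]; rewrite lee_fin phihi//.
  by rewrite ltW.
Qed.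

Lemma std_normal_cdf_nondecreasing a b : a <= b -> Phi a <= Phi b.
Proof.
move=> ab; rewrite -subr_ge0 -(mul0r (b - a)).
by apply: std_normal_cdf_increment_ge => // t _; exact: normal_pdf_ge0.
Qed.

Lemma std_normal_cdf_lipschitz a b : a <= b ->
  Phi b - Phi a <= normal_peak 1 * (b - a).
Proof.
move=> ab; apply: std_normal_cdf_increment_le => // t _.
by rewrite normal_pdf_ub ?oner_neq0.
Qed.

(** The exact form of the statement that the ratio of the density at two points
    at distance [h] is close to [1 - t h]. *)
Lemma std_normal_pdfD t h : phi (t + h) = phi t * expR (- (t * h) - h ^+ 2 / 2).
Proof.
rewrite !std_normal_pdfE -[RHS]mulrA -expRD; congr (_ * expR _); by field.
Qed.

(** The exponent of the density changes by at most [(M + 1) h] over a cell of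
    width [h] starting in [[-M, M]]. *)
Lemma std_normal_cdf_small_increment M t h : `|t| <= M -> 0 < h <= 1 ->
  phi t * h * expR (- ((M + 1) * h)) <= Phi (t + h) - Phi t
    <= phi t * h * expR ((M + 1) * h).
Proof.
rewrite ler_norml => /andP[Mt tM] /andP[h0 h1]; have th : t <= t + h by lra.
have pt0 := std_normal_pdf_gt0 t.
have phi_cmp u : t <= u <= t + h -> phi t * expR (- ((M + 1) * h)) <= phi u
    <= phi t * expR ((M + 1) * h).
  move=> /andP[tu uth]; have -> : u = t + (u - t) by lra.
  by rewrite std_normal_pdfD !ler_pM2l// !ler_expR; apply/andP; split; nra.
rewrite !(mulrAC _ h); have Eh : h = t + h - t by rewrite addrC addKr.
apply/andP; split.
- rewrite {2}Eh; apply: std_normal_cdf_increment_ge => //.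
    by rewrite mulr_ge0 ?expR_ge0// ltW.
  by move=> u /phi_cmp /andP[].
- rewrite [X in _ <= _ * X]Eh.
  by apply: std_normal_cdf_increment_le => // u /phi_cmp /andP[].
Qed.

Let idRV : measurableTypeR R -> R := idfun.

#[local] HB.instance Definition _ :=
  @isMeasurableFun.Build _ _ _ _ idRV (@measurable_id _ _ setT).

Lemma std_normal_tails (e : R) : 0 < e ->
  \forall M \near +oo, Phi (- M) <= e /\ 1 - e <= Phi M.
Proof.
move=> e0.
have /cvgNy_compNP := @cvg_cdfNy0 _ _ _ _ (idRV : {RV (normal_prob 0 1) >-> R}).
move=> /fine_cvgP[_ /cvgrPdist_le/(_ _ e0) H0].
have /fine_cvgP[_ /cvgrPdist_le/(_ _ e0) H1] :=
  @cvg_cdfy1 _ _ _ _ (idRV : {RV (normal_prob 0 1) >-> R}).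
apply: filterS2 H0 H1 => M /=; rewrite -!/(std_normal_cdf _) !ler_norml => H0 H1.
by split; lra.
Qed.

End std_normal.

(** * Log-concave sequences *)

Section log_concave.
Context {R : realType}.
Variable a : nat -> R.
Hypothesis a_ge0 : forall i, 0 <= a i.
(* The ratios [a i.+1 / a i] are nonincreasing, written without division so
   that zeros are allowed. *)
Hypothesis a_log_concave : forall i j, (i <= j)%N -> a i * a j.+1 <= a i.+1 * a j.
Implicit Types (u v i n : nat) (r : R).

Lemma log_concave_ratio_le u i r : (u <= i)%N -> 0 < a u ->
  a u.+1 <= r * a u -> a i.+1 <= r * a i.
Proof.
move=> ui u0 ur; rewrite -(ler_pM2l u0); apply: le_trans (a_log_concave ui) _.
by rewrite mulrCA mulrA; apply: ler_wpM2r.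
Qed.

Lemma log_concave_ratio_ge u i r : (i <= u)%N -> 0 < a u ->
  r * a u <= a u.+1 -> r * a i <= a i.+1.
Proof.
move=> iu u0 ur; rewrite -(ler_pM2r u0); apply: le_trans (a_log_concave iu).
by rewrite mulrAC mulrC; apply: ler_wpM2l.
Qed.

Lemma log_concave_nonincreasing u i j : (u <= i)%N -> (i <= j)%N -> 0 < a u ->
  a u.+1 <= a u -> a j <= a i.
Proof.
move=> ui ij u0 ur; rewrite -(subnKC ij); elim: (j - i)%N => [|n].
  by rewrite addn0.
rewrite addnS; apply: le_trans; rewrite -[leRHS]mul1r.
by apply: (log_concave_ratio_le _ u0); rewrite ?mul1r// (leq_trans ui)// leq_addr.
Qed.

Lemma log_concave_nondecreasing u i j : (i <= j)%N -> (j <= u.+1)%N -> 0 < a u ->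
  a u <= a u.+1 -> a i <= a j.
Proof.
move=> ij ju u0 ur; move: ju; rewrite -(subnKC ij).
elim: (j - i)%N => [|n IH]; first by rewrite addn0.
rewrite addnS => inu; apply: (le_trans (IH (ltnW inu))).
by rewrite -[leLHS]mul1r; apply: (log_concave_ratio_ge _ u0); rewrite ?mul1r.
Qed.

(** Past [v] the sequence decays at least geometrically with ratio [r], so its
    tail is at most [a v / (1 - r)]; and [a v] is at most each of the [v - u]
    values from [u] on, whose sum is at most 1. *)
Lemma log_concave_right_tail u v n r : (u <= v <= n)%N -> 0 < a u -> 0 < a v ->
  a u.+1 <= a u -> a v.+1 <= r * a v -> r < 1 -> \sum_(0 <= i < n) a i <= 1 ->
  (1 - r) * (v - u)%:R * \sum_(v <= i < n) a i <= 1.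
Proof.
move=> /andP[uv vn] u0 v0 ur vr r1 sum1.
have tail : (1 - r) * \sum_(v <= i < n) a i <= a v.
  apply: (@le_trans _ _ (a v - a n)); last by rewrite lerBlDr lerDl.
  rewrite -[leRHS]opprB -(telescope_sumr _ vn) -sumrN mulr_sumr.
  apply: ler_sum_nat => i /andP[vi _]; have := log_concave_ratio_le vi v0 vr; lra.
have near_mode : (v - u)%:R * a v <= 1.
  apply: le_trans sum1; rewrite (big_cat_nat (leq0n u))/=; last exact: leq_trans vn.
  rewrite (big_cat_nat uv vn)/= addrCA -[leLHS]addr0 lerD//; last first.
    by rewrite addr_ge0// sumr_ge0.
  rewrite mulr_natl -sumr_const_nat.
  apply: ler_sum_nat => i /andP[ui iv].
  exact: (log_concave_nonincreasing ui (ltnW iv) u0 ur).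
apply: le_trans near_mode; rewrite mulrAC mulrC.
by rewrite ler_wpM2l.
Qed.

(** Mirror image of [log_concave_right_tail]: below [u] the sequence decays
    geometrically, and [a u] is the least of the values between [u] and [v]. *)
Lemma log_concave_left_tail u v n r : (u <= v <= n)%N -> 0 < a u -> 0 < a v ->
  a v <= a v.+1 -> r * a u <= a u.+1 -> 1 < r -> \sum_(0 <= i < n) a i <= 1 ->
  (r - 1) * (v - u)%:R * \sum_(0 <= i < u) a i <= 1.
Proof.
move=> /andP[uv vn] u0 v0 vr ur r1 sum1.
have tail : (r - 1) * \sum_(0 <= i < u) a i <= a u.
  apply: (@le_trans _ _ (a u - a 0)); last by rewrite lerBlDr lerDl.
  rewrite -(telescope_sumr _ (leq0n u)) mulr_sumr.
  apply: ler_sum_nat => i /= iu; have := log_concave_ratio_ge (ltnW iu) u0 ur; lra.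
have near_mode : (v - u)%:R * a u <= 1.
  apply: le_trans sum1; rewrite (big_cat_nat (leq0n u))/=; last exact: leq_trans vn.
  rewrite (big_cat_nat uv vn)/= addrCA -[leLHS]addr0 lerD//; last first.
    by rewrite addr_ge0// sumr_ge0.
  rewrite mulr_natl -sumr_const_nat.
  apply: ler_sum_nat => i /andP[ui iv].
  exact: (log_concave_nondecreasing ui (leqW (ltnW iv)) v0 vr).
apply: le_trans near_mode; rewrite mulrAC mulrC.
by rewrite ler_wpM2l.
Qed.

End log_concave.

(** * Sequences with Gaussian ratios *)

Section lattice.
Context {R : realType}.
Implicit Types (mu s x M e : R) (i j y n : nat).
Local Notation phi := (@normal_pdf R 0 1).
Local Notation Phi := (@std_normal_cdf R).

Definition count_standardize_le mu s x : nat := (Num.truncn (mu + s * x)).+1.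

Lemma standardizeS mu s y : standardize mu s y.+1 = standardize mu s y + s^-1.
Proof. by rewrite /standardize -natr1 addrAC mulrDl mul1r. Qed.

Lemma standardizeB mu s i j : (i <= j)%N ->
  standardize mu s j - standardize mu s i = (j - i)%:R / s.
Proof. by move=> ij; rewrite /standardize -mulrBl natrB//; congr (_ / _); lra. Qed.

Lemma le_standardize mu s : 0 < s ->
  {homo standardize mu s : i j / (i <= j)%N >-> i <= j}.
Proof.
by move=> s0 i j ij; rewrite -subr_ge0 standardizeB// divr_ge0// ltW.
Qed.

Lemma lt_count_standardize mu s x y : 0 < s -> 0 <= mu + s * x ->
  (y < count_standardize_le mu s x)%N = (standardize mu s y <= x).
Proof.
move=> s0 x0; rewrite ltnS truncn_ge_nat// /standardize ler_pdivrMr//.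
by rewrite lerBlDl (mulrC x).
Qed.

Lemma standardize_count mu s x : 0 < s -> 0 <= mu + s * x ->
  x < standardize mu s (count_standardize_le mu s x) <= x + s^-1.
Proof.
move=> s0 x0; rewrite ltNge -(lt_count_standardize _ s0 x0) ltnn/=.
by rewrite standardizeS lerD2r -(lt_count_standardize _ s0 x0).
Qed.

Lemma count_standardizeB mu s x x' : 0 < s -> 0 <= mu + s * x -> x <= x' ->
  s * (x' - x) - 1 <= (count_standardize_le mu s x' - count_standardize_le mu s x)%:R.
Proof.
move=> s0 x0 xx'.
have x'0 : 0 <= mu + s * x' by rewrite (le_trans x0)// lerD2l ler_pM2l.
have cc : (count_standardize_le mu s x <= count_standardize_le mu s x')%N.
  by rewrite ltnS le_truncn// lerD2l ler_pM2l.
have /andP[_ cx] := standardize_count s0 x0.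
have /andP[cx' _] := standardize_count s0 x'0.
rewrite -[leRHS](divfK (lt0r_neq0 s0)) -(standardizeB mu s)//.
have -> : s * (x' - x) - 1 = (x' - x - s^-1) * s.
  by rewrite [RHS]mulrBl mulVf ?lt0r_neq0// mulrC.
rewrite ler_pM2r//; lra.
Qed.

(** The discrete counterpart of [phi' = - t phi]: a normal density sampled with
    mesh [s^-1] satisfies this with [e] of order [s^-1]. *)
Definition gaussian_ratio_on (a : nat -> R) mu s M e := forall y,
  `|standardize mu s y| <= M ->
  0 < a y /\ `|a y.+1 / a y - (1 - standardize mu s y / s)| <= e / s.

(** The companion of [1 + x <= expR x], with the second-order loss that makes
    it hold on this side. *)
Lemma expR_le_1B (u : R) : u <= 1 / 2 -> expR (- (u + 2 * u ^+ 2)) <= 1 - u.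
Proof.
move=> u2; rewrite expRN invf_ple ?posrE ?expR_gt0//; last lra.
apply: le_trans (expR_ge1Dx _).
rewrite -[leLHS]mul1r ler_pdivrMr; last lra.
have : 0 <= u ^+ 2 * (1 - 2 * u) by rewrite mulr_ge0 ?sqr_ge0//; lra.
lra.
Qed.

(* [s_large] makes every second-order effect of the mesh [s^-1] at most [e]
   times a first-order one, uniformly on the window [[-M, M]]. *)
Section window.
Variables (a : nat -> R) (mu s M e : R).
Hypothesis M_ge1 : 1 <= M.
Hypothesis e01 : 0 < e <= 1.
Hypothesis s_large : 4 * (M + 1) ^+ 2 <= e * s.
Hypothesis a_ratio : gaussian_ratio_on a mu s M e.
Local Notation t := (standardize mu s).
Local Notation h := (s^-1).

Let s_gt0 : 0 < s.
Proof.
have M1 := M_ge1; have /andP[e0 _] := e01; rewrite -(pmulr_rgt0 _ e0).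
by apply: lt_le_trans s_large; rewrite mulr_gt0// exprn_gt0//; lra.
Qed.

Let h_gt0 : 0 < h. Proof. by rewrite invr_gt0. Qed.
Let sh : s * h = 1. Proof. by rewrite mulfV ?lt0r_neq0. Qed.
Let eh_large : 4 * (M + 1) ^+ 2 * h <= e.
Proof. by rewrite ler_pdivrMr. Qed.
Let Mh_small : 8 * ((M + 1) * h) <= e.
Proof.
apply: le_trans eh_large; rewrite mulrA ler_pM2r//.
have M1 := M_ge1; have : 0 <= (M + 1) * (M - 1) by rewrite mulr_ge0//; lra.
lra.
Qed.

Let h_small : 16 * h <= e.
Proof.
have M1 := M_ge1; apply: le_trans Mh_small.
by rewrite mulrA ler_pM2r//; lra.
Qed.

Lemma gaussian_ratio_expR y : `|t y| <= M ->
  a y * expR (- (t y * h) - 2 * e * h) <= a y.+1 <=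
  a y * expR (- (t y * h) + e * h).
Proof.
move=> tM; have [ay0] := a_ratio tM; move: tM; rewrite !ler_norml.
move=> /andP[Mt tM] /andP[]; set r := a y.+1 / a y => r1 r2.
have -> : a y.+1 = a y * r by rewrite mulrC divfK ?lt0r_neq0.
rewrite !ler_pM2l//; apply/andP; split; last first.
  by apply: le_trans (expR_ge1Dx _); lra.
set u := (t y + e) * h.
have M1 := M_ge1; have /andP[e0 e1] := e01; have Mh := Mh_small.
have uM : u <= (M + 1) * h by rewrite ler_pM2r//; lra.
have u2 : u <= 1 / 2 by lra.
apply: (@le_trans _ _ (1 - u)); last by rewrite /u; lra.
apply: le_trans (expR_le_1B u2); rewrite ler_expR.
suff : 2 * u ^+ 2 <= e * h by rewrite /u; lra.
rewrite /u exprMn mulrA [h ^+ 2]expr2 mulrA ler_pM2r//.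
apply: le_trans eh_large; rewrite ler_pM2r//.
nra.
Qed.

(* The quotient by the density sampled at the same points: each step changes it
   by a factor between [expR (- 3 e / s)] and [expR (3 e / s)], and the window
   has at most [2 M s] steps. *)
Let w y := a y / phi (t y).

Let w_step y : `|t y| <= M ->
  w y * expR (- (3 * e * h)) <= w y.+1 <= w y * expR (3 * e * h).
Proof.
move=> tM; have /andP[lo hi] := gaussian_ratio_expR tM.
have [ay0 _] := a_ratio tM.
have p0 := std_normal_pdf_gt0 (t y).
have hh : h ^+ 2 / 2 <= e * h.
  by have h16 := h_small; have h0 := h_gt0; rewrite expr2 mulrAC ler_pM2r//; lra.
have eh0 : 0 <= e * h.
  by have /andP[e0 _] := e01; rewrite mulr_ge0// ltW.
have h20 : 0 <= h ^+ 2 by rewrite sqr_ge0.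
have -> : w y.+1 = a y.+1 * expR (t y * h + h ^+ 2 / 2) / phi (t y).
  rewrite /w standardizeS std_normal_pdfD invfM -expRN mulrA mulrAC.
  by congr (_ * expR _ / _); lra.
have wE u : w y * expR u = a y * expR u / phi (t y) by rewrite /w mulrAC.
rewrite !wE !ler_pM2r ?invr_gt0//; apply/andP; split.
- apply: le_trans (ler_wpM2r (expR_ge0 _) lo).
  by rewrite -[leRHS]mulrA -expRD ler_pM2l// ler_expR; lra.
- apply: (le_trans (ler_wpM2r (expR_ge0 _) hi)).
  by rewrite -[leLHS]mulrA -expRD ler_pM2l// ler_expR; lra.
Qed.

Let w_window y0 n : (forall i, (y0 <= i < y0 + n)%N -> `|t i| <= M) ->
  w y0 * expR (- (3 * e * h * n%:R)) <= w (y0 + n) <= w y0 * expR (3 * e * h * n%:R).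
Proof.
elim: n => [|n IH] inM; first by rewrite addn0 !mulr0 oppr0 expR0 mulr1 lexx.
have /andP[lo hi] : w y0 * expR (- (3 * e * h * n%:R)) <= w (y0 + n)
    <= w y0 * expR (3 * e * h * n%:R).
  by apply: IH => i /andP[i0 i1]; apply: inM; rewrite i0 addnS ltnW.
have /w_step/andP[lo' hi'] : `|t (y0 + n)| <= M.
  by apply: inM; rewrite leq_addr addnS ltnS leqnn.
rewrite addnS -[n.+1%:R]natr1 !(mulrDr (3 * e * h)) mulr1 opprD !expRD !mulrA.
apply/andP; split.
- by apply: le_trans lo'; rewrite ler_pM2r ?expR_gt0.
- by apply: (le_trans hi'); rewrite ler_pM2r ?expR_gt0.
Qed.

(** Up to a factor [expR (e (6 M + 1))], the sequence is proportional to the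
    normal probabilities of the cells of the lattice: [6 M e] accumulates over
    the at most [2 M s] steps of the window, the last [e] is the variation of
    the density inside a cell. *)
Lemma gaussian_ratio_profile y0 y : (y0 <= y)%N -> - M <= t y0 -> t y <= M ->
  a y0 / phi (t y0) * s * expR (- (e * (6 * M + 1))) *
    (Phi (t y.+1) - Phi (t y)) <= a y <=
  a y0 / phi (t y0) * s * expR (e * (6 * M + 1)) *
    (Phi (t y.+1) - Phi (t y)).
Proof.
move=> y0y Mt0 tM; set d := e * _; rewrite -/(w y0); set K := w y0 * s.
have M1 := M_ge1; have /andP[e0 e1] := e01; have Mh := Mh_small.
have h16 := h_small; have h0 := h_gt0.
have Mt : - M <= t y by apply: (le_trans Mt0); exact: le_standardize.
have tyM : `|t y| <= M by rewrite ler_norml Mt tM.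
have h1 : 0 < h <= 1 by rewrite h_gt0/=; lra.
have /andP[lo hi] := std_normal_cdf_small_increment tyM h1.
have ww : forall i, (y0 <= i < y0 + (y - y0))%N -> `|t i| <= M.
  move=> i; rewrite subnKC// => /andP[i0 iy]; rewrite ler_norml.
  rewrite (le_trans Mt0) ?le_standardize//=.
  by apply: le_trans tM; rewrite le_standardize// ltnW.
have := w_window ww; rewrite subnKC//.
have -> : 3 * e * h * (y - y0)%:R = 3 * e * ((y - y0)%:R * h) by ring.
move=> /andP[wlo whi].
have nM : (y - y0)%:R / s <= 2 * M by rewrite -(standardizeB mu s)//; lra.
have w0 : 0 < w y0.
  have [] := a_ratio (y := y0); last first.
    by move=> a0 _; rewrite divr_gt0// std_normal_pdf_gt0.
  by rewrite ler_norml Mt0 (le_trans _ tM)// le_standardize.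
have p0 := std_normal_pdf_gt0 (t y).
have Ea : a y = w y * phi (t y) by rewrite /w divfK ?lt0r_neq0.
have K0 : 0 < K by rewrite mulr_gt0.
rewrite standardizeS Ea; apply/andP; split.
- apply: (@le_trans _ _ (w y0 * expR (- (3 * e * ((y - y0)%:R / s))) * phi (t y))).
    apply: (@le_trans _ _ (K * expR (- d) * (phi (t y) * h * expR ((M + 1) * h)))).
      by rewrite ler_pM2l// mulr_gt0// expR_gt0.
    have -> : K * expR (- d) * (phi (t y) * h * expR ((M + 1) * h)) =
       (s * h) * (w y0 * (expR (- d) * expR ((M + 1) * h)) * phi (t y)).
      by rewrite /K; ring.
    rewrite sh mul1r ler_pM2r// ler_pM2l// -expRD ler_expR /d.
    nra.
  by rewrite ler_pM2r.
- apply: (@le_trans _ _ (w y0 * expR (3 * e * ((y - y0)%:R / s)) * phi (t y))).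
    by rewrite ler_pM2r.
  apply: (@le_trans _ _
    (K * expR d * (phi (t y) * h * expR (- ((M + 1) * h))))); last first.
    by rewrite ler_pM2l// mulr_gt0// expR_gt0.
  have -> : K * expR d * (phi (t y) * h * expR (- ((M + 1) * h))) =
       (s * h) * (w y0 * (expR d * expR (- ((M + 1) * h))) * phi (t y)).
    by rewrite /K; ring.
  rewrite sh mul1r ler_pM2r// ler_pM2l// -expRD ler_expR /d.
  nra.
Qed.

End window.
End lattice.

(** * From Gaussian ratios to the normal distribution function *)

Section discrete_normal_approximation.
Context {R : realType}.
Implicit Types (a f : nat -> R) (mu s x M e z : R).
Local Notation Phi := (@std_normal_cdf R).
Local Notation cut := count_standardize_le.

Lemma sum_nat_ge0 a i j : (forall y, 0 <= a y) -> 0 <= \sum_(i <= y < j) a y.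
Proof. by move=> a0; exact: sumr_ge0. Qed.

(** Both tails are [O(1 / M ^ 2)]: the decay ratio at the edge of the window
    differs from 1 by at least [(M - 2) / s], and at least [s (M - 3)] lattice
    points separate that edge from a point at standardized distance at most 2
    from 0 beyond which the sequence is already monotone. *)
Lemma log_concave_gaussian_tails a mu s M e n :
  (forall i, 0 <= a i) ->
  (forall i j, (i <= j)%N -> a i * a j.+1 <= a i.+1 * a j) ->
  \sum_(0 <= i < n) a i <= 1 ->
  1 <= s -> 0 <= mu - s * M -> 3 < M -> 0 < e <= 1 ->
  gaussian_ratio_on a mu s (M + 1) e -> (cut mu s M <= n)%N ->
  (M - 2) * (M - 3) * \sum_(0 <= i < cut mu s (- M)) a i <= 1 /\
  (M - 2) * (M - 3) * \sum_(cut mu s M <= i < n) a i <= 1.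
Proof.
move=> a0 alc asum s1 muM M3 /andP[e0 e1] ratio Mn.
have s0 : 0 < s by lra.
have h0 : 0 < s^-1 by rewrite invr_gt0.
have h1 : s^-1 <= 1 by rewrite invf_le1.
have mu_ge x : - M <= x -> 0 <= mu + s * x.
  move=> Mx; apply: (le_trans muM); rewrite lerD2l -mulrN ler_pM2l//.
have cutP x : - M <= x -> x <= M -> let y := cut mu s x in
    let t := standardize mu s y in [/\ x < t, t <= x + s^-1, 0 < a y,
      a y.+1 <= (1 - (t - e) / s) * a y & (1 - (t + e) / s) * a y <= a y.+1].
  move=> Mx xM y t; have /andP[xt tx] := standardize_count s0 (mu_ge x Mx).
  have [|ay0] := ratio y; first by rewrite ler_norml; apply/andP; split; lra.
  rewrite ler_norml => /andP[r1 r2]; split => //.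
    by rewrite -ler_pdivrMr//; rewrite -/t in r1 r2; lra.
  by rewrite -ler_pdivlMr//; rewrite -/t in r1 r2; lra.
have cut_le x x' : x <= x' -> (cut mu s x <= cut mu s x')%N.
  by move=> xx'; rewrite ltnS le_truncn// lerD2l ler_pM2l.
have gap x x' : - M <= x -> x + (M - 2) <= x' ->
    s * (M - 3) <= (cut mu s x' - cut mu s x)%:R.
  move=> Mx xx'; apply: (@le_trans _ _ (s * (x' - x) - 1)); last first.
    by apply: count_standardizeB => //; [exact: mu_ge | lra].
  have : s * (M - 2) <= s * (x' - x) by rewrite ler_pM2l//; lra.
  lra.
have rearrange d k S : 0 <= S -> (M - 2) / s <= d -> s * (M - 3) <= k ->
    d * k * S <= 1 -> (M - 2) * (M - 3) * S <= 1.
  move=> S0 d1 k1; apply: le_trans; rewrite ler_wpM2r//.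
  have -> : (M - 2) * (M - 3) = (M - 2) / s * (s * (M - 3)).
    by rewrite mulrA divfK ?lt0r_neq0.
  by rewrite ler_pM// ?divr_ge0 ?mulr_ge0//; lra.
split.
- have [||t1 t2 au ru ru'] := cutP (- M); [lra..|].
  have [||t3 t4 av rv rv'] := cutP (- 2); [lra..|].
  set tu := standardize _ _ _ in t1 t2 ru ru'.
  set tv := standardize _ _ _ in t3 t4 rv rv'.
  apply: (rearrange (1 - (tu + e) / s - 1) (cut mu s (- 2) - cut mu s (- M))%:R).
  + exact: sum_nat_ge0.
  + rewrite addrAC subrr add0r -mulNr ler_pM2r//; lra.
  + by apply: gap; lra.
  apply: (log_concave_left_tail (n := n) a0 alc) => //.
  + by rewrite cut_le ?(leq_trans _ Mn) ?cut_le//; lra.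
  + apply: le_trans rv'; rewrite -[leLHS]mul1r ler_pM2r// lerDl -mulNr.
    by rewrite divr_ge0//; lra.
  + by rewrite ltrDl -mulNr divr_gt0//; lra.
- have [||t1 t2 au ru ru'] := cutP 1; [lra..|].
  have [||t3 t4 av rv rv'] := cutP M; [lra..|].
  set tu := standardize _ _ _ in t1 t2 ru ru'.
  set tv := standardize _ _ _ in t3 t4 rv rv'.
  apply: (rearrange (1 - (1 - (tv - e) / s)) (cut mu s M - cut mu s 1)%:R).
  + exact: sum_nat_ge0.
  + rewrite opprB addrCA subrr addr0 ler_pM2r//; lra.
  + by apply: gap; lra.
  apply: (log_concave_right_tail (u := cut mu s 1) a0 alc) => //.
  + by rewrite Mn cut_le//; lra.
  + apply: (le_trans ru); rewrite -[leRHS]mul1r ler_pM2r// gerBl.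
    by rewrite divr_ge0//; lra.
  + by rewrite gtrBl divr_gt0//; lra.
Qed.

(** Two sequences proportional up to a factor [r] have partial sums with the
    same proportion of their totals up to [r ^ 2]; the constant [K] is
    gone. *)
Lemma proportional_sums (f d : nat -> R) (K r : R) i j k : (i <= j <= k)%N ->
  0 < K -> 0 < r -> (forall y, 0 <= d y) ->
  (forall y, (i <= y < k)%N -> K / r * d y <= f y <= K * r * d y) ->
  (\sum_(i <= y < j) f y) * (\sum_(i <= y < k) d y) <=
    r ^+ 2 * ((\sum_(i <= y < j) d y) * (\sum_(i <= y < k) f y)) /\
  (\sum_(i <= y < j) d y) * (\sum_(i <= y < k) f y) <=
    r ^+ 2 * ((\sum_(i <= y < j) f y) * (\sum_(i <= y < k) d y)).
Proof.
move=> /andP[ij jk] K0 r0 d0 fd.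
have sums l : (l <= k)%N -> K / r * (\sum_(i <= y < l) d y) <=
    \sum_(i <= y < l) f y <= K * r * (\sum_(i <= y < l) d y).
  move=> lk; rewrite !mulr_sumr !ler_sum_nat// => y /andP[iy yl];
  by have /andP[] : K / r * d y <= f y <= K * r * d y
    by apply: fd; rewrite iy (leq_trans yl).
have /andP[j1 j2] := sums j jk; have /andP[k1 k2] := sums k (leqnn k).
have dj0 := sum_nat_ge0 i j d0; have dk0 := sum_nat_ge0 i k d0.
move: j1 j2 k1 k2 dj0 dk0.
set F := \sum_(i <= y < j) f y; set G := \sum_(i <= y < k) f y.
set D := \sum_(i <= y < j) d y; set E := \sum_(i <= y < k) d y.
move=> j1 j2 k1 k2 D0 E0.
have lower X Y : K / r * X <= Y -> K * X <= r * Y.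
  by move=> XY; rewrite -ler_pdivrMl// mulrC mulrAC.
split.
- apply: (@le_trans _ _ (K * r * D * E)); first by rewrite ler_wpM2r.
  have -> : K * r * D * E = r * D * (K * E) by ring.
  have -> : r ^+ 2 * (D * G) = r * D * (r * G) by ring.
  by rewrite ler_wpM2l ?lower// mulr_ge0// ltW.
- apply: (@le_trans _ _ (D * (K * r * E))); first by rewrite ler_wpM2l.
  have -> : D * (K * r * E) = r * E * (K * D) by ring.
  have -> : r ^+ 2 * (F * E) = r * E * (r * F) by ring.
  by rewrite ler_wpM2l ?lower// mulr_ge0// ltW.
Qed.

(** Here [A] is the mass left of the window, [D] that of the window and [B] that
    of its part up to [x]; [c] and [b] are the normal counterparts of [D] and
    [B]. Since [D] and [c] are nearly 1, near-proportionality of [(B, D)] to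
    [(b, c)] becomes closeness of [B] to [b]. *)
Lemma cancel_proportionality (A B D b c r x z : R) :
  0 <= A <= z -> 0 <= B <= D -> 1 - 2 * z <= D <= 1 ->
  0 <= b <= c -> 1 - 2 * z <= c <= 1 -> x - z <= b <= x + z ->
  r <= 1 + z -> B * c <= r * (b * D) -> b * D <= r * (B * c) ->
  `|A + B - x| <= 5 * z.
Proof.
move=> /andP[A0 Az] /andP[B0 BD] /andP[D0 D1] /andP[b0 bc] /andP[c0 c1].
move=> /andP[xb bx] rz BcbD bDBc.
have B1 : B <= 1 := le_trans BD D1.
have b1 : b <= 1 := le_trans bc c1.
have z0 : 0 <= z := le_trans A0 Az.
have D_0 : 0 <= D := le_trans B0 BD.
have c_0 : 0 <= c := le_trans b0 bc.
have approx X Y : 0 <= X <= 1 -> Y <= r * X -> Y <= X + z.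
  move=> /andP[X0 X1] /le_trans; apply.
  apply: (le_trans (ler_wpM2r X0 rz)); rewrite mulrDl mul1r lerD2l.
  by rewrite ler_piMr.
have defect X Y : 0 <= X <= 1 -> 1 - 2 * z <= Y -> X - 2 * z <= X * Y.
  move=> /andP[X0 X1] zY; have : X * (1 - Y) <= X * (2 * z).
    by rewrite ler_wpM2l//; lra.
  have : X * (2 * z) <= 2 * z by rewrite ler_piMl// mulr_ge0.
  lra.
have {}BcbD : B * c <= b * D + z.
  by apply: approx BcbD; rewrite mulr_ge0 ?mulr_ile1.
have {}bDBc : b * D <= B * c + z.
  by apply: approx bDBc; rewrite mulr_ge0 ?mulr_ile1.
have bD : b - 2 * z <= b * D by apply: defect => //; rewrite b0.
have Bc : B - 2 * z <= B * c by apply: defect => //; rewrite B0.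
have bD_le : b * D <= b by rewrite ler_piMr.
have Bc_le : B * c <= B by rewrite ler_piMr.
clear -A0 Az xb bx BcbD bDBc bD Bc bD_le Bc_le z0.
by rewrite ler_norml; apply/andP; split; lra.
Qed.

(** Non-asymptotic form of the limit theorem below. The window is [[-M, M]];
    the ratio condition is asked on [[-M - 1, M + 1]] because the lattice points
    that cut the window overshoot its ends by up to [s^-1]. *)
Lemma discrete_normal_approximation a f mu s x M e z (L : nat) :
  (forall i, 0 <= a i) ->
  (forall i j, (i <= j)%N -> a i * a j.+1 <= a i.+1 * a j) ->
  (forall i, a i <= f i <= 2 * a i) ->
  (forall i, `|standardize mu s i| <= M -> f i <= (1 + e) * a i) ->
  (forall n, (L <= n)%N -> \sum_(0 <= i < n) f i = 1) ->
  gaussian_ratio_on a mu s (M + 1) e ->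
  3 < M -> 0 < e <= 1 -> 4 * (M + 2) ^+ 2 <= e * s -> 0 <= mu - s * M ->
  `|x| <= M -> 2 <= z * ((M - 2) * (M - 3)) ->
  expR (e * (6 * (M + 1) + 2)) ^+ 2 <= 1 + z ->
  Phi (- M + 1) <= z -> 1 - z <= Phi M -> normal_peak 1 / s <= z ->
  `|\sum_(0 <= i < cut mu s x) f i - Phi x| <= 5 * z.
Proof.
move=> a0 alc af fwin fsum ratio M3 e01 s_large muM xM zM ze z1 z2 z3.
have /andP[e0 e1] := e01; have M1 : 1 <= M + 1 by lra.
have s_large' : 4 * (M + 1 + 1) ^+ 2 <= e * s.
  by have -> : M + 1 + 1 = M + 2 by lra.
have s1 : 1 <= s.
  have s0 : 0 < s.
    rewrite -(pmulr_rgt0 _ e0); apply: lt_le_trans s_large.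
    by rewrite mulr_gt0// exprn_gt0//; lra.
  have : 1 <= (M + 2) ^+ 2 by apply: exprn_ege1; lra.
  have : e * s <= s by rewrite ger_pMl.
  lra.
have s0 : 0 < s by lra.
have h0 : 0 < s^-1 by rewrite invr_gt0.
have h1 : s^-1 <= 1 by rewrite invf_le1.
have f0 i : 0 <= f i by have /andP[afi _] := af i; apply: le_trans afi.
have /andP[Mx x_M] : - M <= x <= M by rewrite -ler_norml.
have mu_ge u : - M <= u -> 0 <= mu + s * u.
  move=> Mu; apply: (le_trans muM); rewrite lerD2l -mulrN ler_pM2l//.
have cut_le u u' : u <= u' -> (cut mu s u <= cut mu s u')%N.
  by move=> uu'; rewrite ltnS le_truncn// lerD2l ler_pM2l.
set y0 := cut mu s (- M); set y1 := cut mu s x; set y2 := cut mu s M.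
have y01 : (y0 <= y1)%N by apply: cut_le.
have y12 : (y1 <= y2)%N by apply: cut_le.
have /andP[t0 t0'] : - M < standardize mu s y0 <= - M + s^-1.
  by apply: standardize_count => //; exact: mu_ge.
have /andP[t1 t1'] : x < standardize mu s y1 <= x + s^-1.
  by apply: standardize_count => //; exact: mu_ge.
have /andP[t2 t2'] : M < standardize mu s y2 <= M + s^-1.
  by apply: standardize_count => //; apply: mu_ge; lra.
(* Far enough both for the total mass to be 1 and to contain the window. *)
pose n := maxn L y2.
have y2n : (y2 <= n)%N by rewrite leq_maxr.
have sumn : \sum_(0 <= i < n) f i = 1 by rewrite fsum// leq_maxl.
have asum : \sum_(0 <= i < n) a i <= 1.
  by rewrite -sumn ler_sum_nat// => i _; have /andP[] := af i.
have [lt rt] := log_concave_gaussian_tails a0 alc asum s1 muM M3 e01 ratio y2n.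
have f2a i j : \sum_(i <= y < j) f y <= 2 * \sum_(i <= y < j) a y.
  by rewrite mulr_sumr ler_sum_nat// => y _; have /andP[] := af y.
have tail S : 0 <= S -> (M - 2) * (M - 3) * S <= 1 -> 2 * S <= z.
  have MM : 0 < (M - 2) * (M - 3) by rewrite mulr_gt0//; lra.
  move=> S0 MS; rewrite -(ler_pM2l MM); lra.
have A_le : \sum_(0 <= i < y0) f i <= z.
  by apply: (le_trans (f2a _ _)); apply: tail => //; exact: sum_nat_ge0.
have T_le : \sum_(y2 <= i < n) f i <= z.
  by apply: (le_trans (f2a _ _)); apply: tail => //; exact: sum_nat_ge0.
pose d y := Phi (standardize mu s y.+1) - Phi (standardize mu s y).
have d0 y : 0 <= d y.
  by rewrite subr_ge0 std_normal_cdf_nondecreasing// le_standardize.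
have ay0 : 0 < a y0.
  have y0M : `|standardize mu s y0| <= M + 1.
    by rewrite ler_norml; apply/andP; split; lra.
  by have [] := ratio y0 y0M.
have cst_gt0 : 0 < a y0 / normal_pdf 0 1 (standardize mu s y0) * s.
  by rewrite mulr_gt0// divr_gt0// std_normal_pdf_gt0.
have [K K0 fd] : exists2 K, 0 < K & forall y, (y0 <= y < y2)%N ->
    K / expR (e * (6 * (M + 1) + 2)) * d y <= f y
    <= K * expR (e * (6 * (M + 1) + 2)) * d y.
  exists (a y0 / normal_pdf 0 1 (standardize mu s y0) * s); first exact: cst_gt0.
  move=> y /andP[y0y yy2].
  have tM : standardize mu s y <= M.
    by rewrite -lt_count_standardize//; apply: mu_ge; lra.
  have tM0 : standardize mu s y0 <= standardize mu s y by exact: le_standardize.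
  have /andP[afy _] := af y.
  have fay : f y <= (1 + e) * a y.
    by apply: fwin; rewrite ler_norml; apply/andP; split; lra.
  have [||lo hi] :=
    andP (gaussian_ratio_profile M1 e01 s_large' ratio y0y _ _); [lra..|].
  have Ed : e * (6 * (M + 1) + 2) = e * (6 * (M + 1) + 1) + e by ring.
  apply/andP; split.
  - apply: le_trans afy; apply: le_trans lo; rewrite ler_wpM2r// ler_pM2l//.
    by rewrite -expRN ler_expR lerN2 Ed lerDl ltW.
  - apply: (le_trans fay); rewrite Ed expRD mulrA mulrAC mulrC.
    by apply: ler_pM => //; [lra | exact: expR_ge1Dx].
have y012 : (y0 <= y1 <= y2)%N by rewrite y01.
have [BD1 BD2] := proportional_sums y012 K0 (expR_gt0 _) d0 fd.
have dsum j : (y0 <= j)%N -> \sum_(y0 <= y < j) d y =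
    Phi (standardize mu s j) - Phi (standardize mu s y0).
  by move=> y0j; rewrite /d (telescope_sumr (fun y => Phi (standardize mu s y))).
have split1 : \sum_(0 <= i < y1) f i =
    \sum_(0 <= i < y0) f i + \sum_(y0 <= i < y1) f i by exact: big_cat_nat.
have split2 : \sum_(0 <= i < y0) f i + \sum_(y0 <= i < y2) f i +
    \sum_(y2 <= i < n) f i = 1.
  by rewrite -sumn -!big_cat_nat// (leq_trans y01).
have B_le : \sum_(y0 <= i < y1) f i <= \sum_(y0 <= i < y2) f i.
  by rewrite [leRHS](big_cat_nat y01)//= lerDl sum_nat_ge0.
have B0 : 0 <= \sum_(y0 <= i < y1) f i by exact: sum_nat_ge0.
have A0 : 0 <= \sum_(0 <= i < y0) f i by exact: sum_nat_ge0.
have T0 : 0 <= \sum_(y2 <= i < n) f i by exact: sum_nat_ge0.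
rewrite split1; move: BD1 BD2 split2 B_le B0 A_le T_le A0 T0.
rewrite !dsum ?(leq_trans y01)//.
have lip : Phi (standardize mu s y1) - Phi x <= z.
  apply: le_trans z3; apply: (le_trans (std_normal_cdf_lipschitz (ltW t1))).
  by rewrite ler_wpM2l ?normal_peak_ge0//; lra.
have P0 : Phi (standardize mu s y0) <= z.
  by apply: le_trans z1; apply: std_normal_cdf_nondecreasing; lra.
have P1 : Phi x <= Phi (standardize mu s y1).
  exact: std_normal_cdf_nondecreasing (ltW t1).
have P2 : 1 - z <= Phi (standardize mu s y2).
  exact: le_trans z2 (std_normal_cdf_nondecreasing (ltW t2)).
have P01 : Phi (standardize mu s y0) <= Phi (standardize mu s y1).
  by apply: std_normal_cdf_nondecreasing; rewrite le_standardize.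
have P12 : Phi (standardize mu s y1) <= Phi (standardize mu s y2).
  by apply: std_normal_cdf_nondecreasing; rewrite le_standardize.
have Q0 := std_normal_cdf_ge0 (standardize mu s y0).
have Q2 := std_normal_cdf_le1 (standardize mu s y2).
move=> BD1 BD2 split2 BD B0 Az Tz A0 T0.
apply: (cancel_proportionality _ _ _ _ _ _ ze BD1 BD2); rewrite ?A0 ?B0 ?BD//.
- move: split2 Az Tz A0 T0; clear=> split2 Az Tz A0 T0.
  by apply/andP; split; lra.
- apply/andP; split; first by rewrite subr_ge0; exact: P01.
  by rewrite lerD2r; exact: P12.
- move: P0 P2 Q0 Q2; clear; move: (Phi (standardize mu s y0)) => p0.
  move: (Phi (standardize mu s y2)) => p2 P0 P2 Q0 Q2.
  by apply/andP; split; lra.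
- move: lip P0 P1 Q0; clear; move: (Phi x) (Phi (standardize mu s y0)) => u p0.
  move: (Phi (standardize mu s y1)) => p1 lip P0 P1 Q0.
  by apply/andP; split; lra.
Qed.

End discrete_normal_approximation.

Section discrete_normal_limit.
Context {R : realType}.
Local Notation Phi := (@std_normal_cdf R).
Local Notation cut := count_standardize_le.

(** The laws [f k] are only asked to be comparable to the log-concave [a k]
    globally, and asymptotically equal to it in each window. The
    log-concavity is what prevents mass from escaping to infinity. *)
Theorem discrete_normal_limit (a f : nat -> nat -> R) (mu s : nat -> R)
    (L : nat -> nat) :
  (forall k i, 0 <= a k i) ->
  (forall k i j, (i <= j)%N -> a k i * a k j.+1 <= a k i.+1 * a k j) ->
  (forall k i, a k i <= f k i <= 2 * a k i) ->
  (forall k n, (L k <= n)%N -> \sum_(0 <= i < n) f k i = 1) ->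
  s k @[k --> \oo] --> +oo ->
  (forall M, \forall k \near \oo, s k * M <= mu k) ->
  (forall M e, 0 < e -> \forall k \near \oo, forall i,
     `|standardize (mu k) (s k) i| <= M -> f k i <= (1 + e) * a k i) ->
  (forall M e, 0 < e -> \forall k \near \oo,
     gaussian_ratio_on (a k) (mu k) (s k) M e) ->
  forall x, \sum_(0 <= i < cut (mu k) (s k) x) f k i @[k --> \oo] --> Phi x.
Proof.
move=> a0 alc af fsum s_oo mu_oo fa ratio x.
apply/cvgrPdist_le => eps eps0; set z := eps / 5.
have z0 : 0 < z by rewrite divr_gt0.
have [M1 [[M1z zM1] M1b]] := @filter_ex _ (pinfty_nbhs R) _ _
  (filterI (std_normal_tails z0) (nbhs_pinfty_ge (num_real (`|x| + 2 / z + 3)))).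
have x0 := normr_ge0 x; have z2 : 0 < 2 / z by rewrite divr_gt0.
pose M := M1 + 1.
have M3 : 3 < M by rewrite /M; lra.
have xM : `|x| <= M by rewrite /M; lra.
have zM : 2 <= z * ((M - 2) * (M - 3)).
  rewrite mulrC -ler_pdivrMr// -[leLHS]mul1r.
  by apply: ler_pM; rewrite ?ler01 ?(ltW z2)// /M; lra.
pose C := 6 * (M + 1) + 2.
have C0 : 0 < C by rewrite /C; lra.
(* [e] is small enough for the accumulated relative error
   [expR (e C) ^ 2 - 1] of the window to be at most [z]. *)
have lnz : 0 < ln (1 + z) by rewrite ln_gt0// ltrDl.
pose e := Num.min 1 (ln (1 + z) / (2 * C)).
have e0 : 0 < e by rewrite lt_min ltr01 divr_gt0// mulr_gt0.
have e1 : e <= 1 by rewrite ge_min lexx.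
have ez : expR (e * C) ^+ 2 <= 1 + z.
  rewrite -expRM_natl -[leRHS]lnK ?posrE ?addr_gt0// ler_expR mulrCA.
  by rewrite -ler_pdivlMr ?mulr_gt0// ge_min lexx orbT.
near=> k.
rewrite distrC -[eps](@divfK _ 5)// mulrC.
apply: (@discrete_normal_approximation _ (a k) _ _ _ _ M e _ (L k)) => //.
- exact: alc.
- by near: k; apply: fa.
- exact: fsum.
- by near: k; apply: ratio.
- by rewrite e0 e1.
- by rewrite -ler_pdivrMl//; near: k; move/cvgryPge : s_oo; apply.
- by rewrite subr_ge0; near: k.
- by have -> : - M + 1 = - M1 by rewrite /M; lra.
- by apply: (le_trans zM1); apply: std_normal_cdf_nondecreasing; rewrite /M; lra.
- rewrite -[leRHS]divr1 ler_pdivrMr; last by near: k; move/cvgryPgt : s_oo; apply.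
  rewrite divr1 -ler_pdivrMl//; near: k; move/cvgryPge : s_oo; apply.
Unshelve. all: by end_near. Qed.

End discrete_normal_limit.

(** * The negative hypergeometric weights *)

Section minority_last.
Context {R : realType}.
Implicit Types (N m c y : nat).

(** The summand of the mass function for draws whose last ball is the [c]-th
    one of the colour with [N - m] balls. *)
Definition minority_last_pmf N m c y : R :=
  'C(2 * c + y - 1, c - 1)%:R * (m ^_ (c + y))%:R * ((N - m) ^_ c)%:R /
  (N ^_ (2 * c + y))%:R.

Definition minority_last_ratio N m c y : R :=
  (2 * c + y)%:R * (m - c - y)%:R / ((c + y).+1%:R * (N - 2 * c - y)%:R).

Local Notation pmf := minority_last_pmf.
Local Notation ratio := minority_last_ratio.

Lemma minority_last_pmf_ge0 N m c y : 0 <= pmf N m c y.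
Proof. by rewrite !mulr_ge0 ?invr_ge0. Qed.

Lemma minority_last_pmf_gt0 N m c y : (0 < c)%N -> (c <= m <= N)%N ->
  (c <= N - m)%N -> (y <= m - c)%N -> 0 < pmf N m c y.
Proof.
move=> c0 cm cNm ym; rewrite divr_gt0 ?mulr_gt0 ?ltr0n ?bin_gt0 ?ffact_gt0//; lia.
Qed.

Lemma minority_last_pmfS N m c y : (0 < c)%N ->
  pmf N m c y.+1 = ratio N m c y * pmf N m c y.
Proof.
move=> c0; rewrite /pmf /ratio !addnS.
have -> : ((2 * c + y).+1 - 1 = 2 * c + y)%N by lia.
have bin : ((c + y).+1%:R * 'C(2 * c + y, c - 1)%:R =
    (2 * c + y)%:R * 'C(2 * c + y - 1, c - 1)%:R :> R).
  rewrite -!natrM; congr _%:R.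
  have := mul_bin_down (2 * c + y) (c - 1).
  by rewrite !subn1 => ->; congr (_ * _)%N; lia.
have -> : ('C(2 * c + y, c - 1)%:R =
    (2 * c + y)%:R * 'C(2 * c + y - 1, c - 1)%:R / (c + y).+1%:R :> R).
  by rewrite -bin mulrC mulKf.
rewrite !ffactnSr !natrM !invfM !subnDA.
ring.
Qed.

Lemma minority_last_ratio_nonincreasing N m c i j : (0 < c)%N ->
  (c <= m <= N)%N -> (c <= N - m)%N -> (i <= j)%N ->
  ratio N m c j <= ratio N m c i.
Proof.
move=> c0 /andP[cm mN] cNm ij; rewrite /ratio.
have [mj|jm] := leqP (m - c) j.
  by rewrite (_ : m - c - j = 0)%N ?mulr0 ?mul0r ?divr_ge0 ?mulr_ge0//; lia.
have den_gt0 k : (k <= j)%N -> 0 < (c + k).+1%:R * (N - 2 * c - k)%:R :> R.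
  by move=> kj; rewrite mulr_gt0// ltr0n; lia.
rewrite ler_pdivrMr ?den_gt0// mulrAC ler_pdivlMr ?den_gt0//.
rewrite -!natrM ler_nat mulnACA [leqRHS]mulnACA.
apply: leq_mul.
- rewrite -(leq_add2l ((2 * c + i) * (c + i).+1)); nia.
have -> : (N - 2 * c - i = (N - m - c) + (m - c - i))%N by lia.
have -> : (N - 2 * c - j = (N - m - c) + (m - c - j))%N by lia.
rewrite !mulnDr [X in (_ + X <= _)%N]mulnC leq_add2r leq_mul2r; lia.
Qed.

Lemma minority_last_pmf_log_concave N m c i j : (0 < c)%N ->
  (c <= m <= N)%N -> (c <= N - m)%N -> (i <= j)%N ->
  pmf N m c i * pmf N m c j.+1 <= pmf N m c i.+1 * pmf N m c j.
Proof.
move=> c0 cm cNm ij; rewrite !minority_last_pmfS// [leLHS]mulrCA -[leRHS]mulrA.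
rewrite ler_wpM2r ?mulr_ge0 ?minority_last_pmf_ge0//.
exact: minority_last_ratio_nonincreasing.
Qed.

(** Drawing [y] further balls of the colour with [n] balls rather than of the
    other one costs a factor [(n - c - i) / (m - c - i)] for each [i < y], and
    each of these is at most the first one, hence at most [rho]. *)
Lemma ffact_minority_le (rho : R) m n c y : (n - c)%:R <= rho * (m - c)%:R ->
  0 <= rho <= 1 -> (c + y <= m)%N ->
  (m ^_ c)%:R * (n ^_ (c + y))%:R <= rho ^+ y * ((m ^_ (c + y))%:R * (n ^_ c)%:R).
Proof.
move=> nm /andP[rho0 rho1]; elim: y => [|y IH] cym.
  by rewrite addn0 expr0 mul1r.
rewrite addnS !ffactnSr !natrM exprS.
rewrite [leLHS]mulrA.
have -> : rho * rho ^+ y * ((m ^_ (c + y))%:R * (m - (c + y))%:R * (n ^_ c)%:R) =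
  rho ^+ y * ((m ^_ (c + y))%:R * (n ^_ c)%:R) * (rho * (m - (c + y))%:R) by ring.
apply: ler_pM => //.
  by apply: IH; lia.
have [nc|cn] := leqP n (c + y).
  by rewrite (_ : n - (c + y) = 0)%N ?mulr_ge0//; lia.
rewrite !subnDA !(@natrB _ _ y); try lia.
rewrite mulrBr lerB// ler_piMl//.
Qed.

(** The upper bound [1 + rho ^+ y] on the relative size of the mass is what
    makes the draws ending with the majority colour negligible. Outside the
    support the falling factorials in the bounds vanish. *)
Lemma max_neg_hypergeometric_pmf_bounds (rho : R) N m c y : (0 < c)%N ->
  (c <= m <= N)%N -> (c <= N - m)%N -> (N - m - c)%:R <= rho * (m - c)%:R ->
  0 <= rho <= 1 ->
  pmf N m c y <= max_neg_hypergeometric_pmf R N m c y <=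
  (1 + rho ^+ y) * pmf N m c y.
Proof.
move=> c0 cm cNm rhom rho01; rewrite /max_neg_hypergeometric_pmf.
have [/andP[rho0 rho1]] := rho01.
have le_Nm : (N - m - c <= m - c)%N.
  by rewrite -(ler_nat R) (le_trans rhom)// ler_piMl.
rewrite (maxn_idPl le_Nm).
case: leqP => ym; last first.
  rewrite /pmf ffact_small; last lia.
  by rewrite mulr0 !mul0r mulr0 lexx.
have cym : (c + y <= m)%N by lia.
have := ffact_minority_le rhom rho01 cym.
set b := 'C(_, _)%:R; rewrite /pmf -/b => le_ab.
have b0 : 0 <= b by [].
set X := (m ^_ (c + y))%:R; set Z := ((N - m) ^_ c)%:R.
set D := (N ^_ _)%:R; have D0 : 0 <= D^-1 by rewrite invr_ge0.
rewrite mulrDr mulrDl (mulrDl 1) mul1r [b * (X * Z)]mulrA lerDl lerD2l.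
apply/andP; split; first by rewrite !mulr_ge0.
have -> : rho ^+ y * (b * X * Z / D) = b * (rho ^+ y * (X * Z)) / D by ring.
by rewrite ler_wpM2r// ler_wpM2l.
Qed.

End minority_last.

(** With [c p / q = q s ^ 2] and [y - mu = t s], the four linear factors of the
    ratio of consecutive weights are [q s ^ 2 / p + t s],
    [n p - q s ^ 2 - t s], [X] and [D]. The ratio is a product [U (1 - V)]:
    [U] is the binomial part, equal to [1 - t / s] up to [O(1 / s ^ 2)], and
    [V], of order [s / n], is the effect of not replacing the balls, which
    [s ^ 3 <= n] makes [O(1 / s ^ 2)] too. *)
Lemma negative_hypergeometric_ratio_expansion (R : realType)
    (p q M e s t n : R) :
  1 / 2 < p < 1 -> q = 1 - p -> `|t| <= M -> 0 < e -> 1 <= s ->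
  2 * M <= q * s -> 4 * (M + 1) <= s -> s ^+ 3 <= n ->
  (2 * (M ^+ 2 + M + 1) / q + 6 * M) / e <= s ->
  let X := q * s ^+ 2 + t * s + 1 in
  let D := n - q * s ^+ 2 / p - t * s in
  [/\ 0 < X, 0 < D, 0 < n * p - q * s ^+ 2 - t * s &
    `|(q * s ^+ 2 / p + t * s) * (n * p - q * s ^+ 2 - t * s) / (X * D)
      - (1 - t / s)| <= e / s].
Proof.
move=> /andP[p2 p1] qE tM e0 s1 Ms Ms' sn se X D.
have q0 : 0 < q by lra.
have p0 : 0 < p by lra.
have s0 : 0 < s by lra.
have M0 : 0 <= M := le_trans (normr_ge0 t) tM.
have s20 : 0 < s ^+ 2 by rewrite exprn_gt0.
have qs20 : 0 < q * s ^+ 2 by rewrite mulr_gt0.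
have tsM : `|t * s| <= M * s by rewrite normrM (gtr0_norm s0) ler_pM2r.
have Msq : M * s <= q * s ^+ 2 / 2.
  have : 2 * M * s <= q * s * s by rewrite ler_pM2r.
  rewrite expr2; lra.
have /andP[ts1 ts2] : - (M * s) <= t * s <= M * s by rewrite -ler_norml.
have X_ge : q * s ^+ 2 / 2 <= X by rewrite /X; lra.
have X0 : 0 < X by lra.
have qp : q * s ^+ 2 / p <= s ^+ 2.
  by rewrite ler_pdivrMr// mulrC ler_pM2l//; lra.
have s3 : s ^+ 3 = s ^+ 2 * s by rewrite exprSr.
have Ms2 : 4 * (M + 1) * s ^+ 2 <= s ^+ 3 by rewrite s3 mulrC ler_pM2l.
have Mss : M * s <= M * s ^+ 2 by rewrite ler_wpM2l// expr2 ler_peMl// ltW.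
have D_ge : s ^+ 3 / 2 <= D by rewrite /D; lra.
have s30 : 0 < s ^+ 3 by rewrite exprn_gt0.
have D0 : 0 < D by lra.
have pD : n * p - q * s ^+ 2 - t * s = p * D - q * (t * s).
  by rewrite /D qE; field; rewrite gt_eqF.
have qts : `|q * (t * s)| <= q * (M * s).
  by rewrite normrM (gtr0_norm q0) ler_pM2l.
have E0 : 0 < p * D - q * (t * s).
  have : q * (M * s) <= p * (M * s) by rewrite ler_wpM2r ?mulr_ge0// ?(ltW s0)//; lra.
  have : p * (M * s) < p * D.
    rewrite ltr_pM2l//; apply: lt_le_trans D_ge.
    have : 4 * (M * s ^+ 2) + 4 * s ^+ 2 <= s ^+ 3 by lra.
    have : 0 <= M * s ^+ 2 by rewrite mulr_ge0// ltW.
    lra.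
  by move: qts; rewrite ler_norml => /andP[_]; lra.
rewrite pD; split => //.
set U := (q * s ^+ 2 + p * (t * s)) / X; set V := q * (t * s) / (p * D).
(* The first term on the right is the error of [U], since
   [U = 1 - (q t s + 1) / X]. *)
have -> : (q * s ^+ 2 / p + t * s) * (p * D - q * (t * s)) / (X * D) - (1 - t / s)
    = (t ^+ 2 * s + t - s) / (s * X) - U * V.
  rewrite /U /V.
  have XE : t * X = q * t * s ^+ 2 + t ^+ 2 * s + t by rewrite /X; ring.
  have -> : t ^+ 2 * s + t - s = t * X - s * (q * (t * s) + 1) by rewrite XE; ring.
  have sE : s * (q * (t * s) + 1) = s * X - s * (q * s ^+ 2 + p * (t * s)).
    by rewrite /X qE; ring.
  rewrite sE; field.
  by rewrite !gt_eqF.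
have U3 : `|U| <= 3.
  rewrite normrM normfV (gtr0_norm X0) ler_pdivrMr//.
  apply: (le_trans (ler_normD _ _)); rewrite (gtr0_norm qs20) normrM (gtr0_norm p0).
  have : p * `|t * s| <= M * s by apply: le_trans tsM; rewrite ler_piMl// ltW.
  lra.
have V2 : `|V| <= 2 * M / s ^+ 2.
  rewrite normrM normfV (@gtr0_norm _ (p * D)) ?mulr_gt0// ler_pdivrMr ?mulr_gt0//.
  apply: (le_trans qts); apply: (@le_trans _ _ (p * (M * s))).
    by rewrite ler_wpM2r ?mulr_ge0// ?(ltW s0)//; lra.
  rewrite [leRHS]mulrCA ler_pM2l//.
  have -> : M * s = 2 * M / s ^+ 2 * (s ^+ 3 / 2) by field; rewrite gt_eqF.
  by rewrite ler_wpM2l// ?divr_ge0 ?mulr_ge0// ltW.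
have W : `|(t ^+ 2 * s + t - s) / (s * X)| <= 2 * (M ^+ 2 + M + 1) / q / s ^+ 2.
  rewrite normrM normfV (@gtr0_norm _ (s * X)) ?mulr_gt0// ler_pdivrMr ?mulr_gt0//.
  apply: (@le_trans _ _ ((M ^+ 2 + M + 1) * s)).
    have t2M : `|t| ^+ 2 <= M ^+ 2 by rewrite ler_pXn2r ?nnegrE.
    have := ler_normB (t ^+ 2 * s + t) s; have := ler_normD (t ^+ 2 * s) t.
    rewrite normrM normrX (gtr0_norm s0).
    have : `|t| ^+ 2 * s <= M ^+ 2 * s by rewrite ler_pM2r.
    have : M <= M * s by rewrite ler_peMr.
    lra.
  have -> : (M ^+ 2 + M + 1) * s =
      2 * (M ^+ 2 + M + 1) / q / s ^+ 2 * (s * (q * s ^+ 2 / 2)).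
    by field; rewrite !gt_eqF.
  have MM0 : 0 <= M ^+ 2 + M + 1 by rewrite !addr_ge0 ?sqr_ge0.
  by rewrite ler_wpM2l ?ler_pM2l// !divr_ge0 ?mulr_ge0// ltW.
apply: (le_trans (ler_normB _ _)).
have UV : `|U * V| <= 3 * (2 * M / s ^+ 2) by rewrite normrM ler_pM.
apply: (@le_trans _ _ ((2 * (M ^+ 2 + M + 1) / q + 6 * M) / s ^+ 2)).
  apply: (le_trans (lerD W UV)); rewrite [leRHS]mulrDl lerD2l.
  by have -> : 3 * (2 * M / s ^+ 2) = 6 * M / s ^+ 2 by ring.
rewrite ler_pdivrMr// expr2 mulrA divfK ?gt_eqF//.
by move: se; rewrite ler_pdivrMr// (mulrC s).
Qed.

Lemma minority_last_pmf_gaussian_ratio (R : realType) (p q M e s mu : R)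
    (N m c : nat) :
  1 / 2 < p < 1 -> q = 1 - p -> m%:R = N%:R * p -> (0 < c)%N -> (c <= N - m)%N ->
  mu = c%:R * (p - q) / q -> s = Num.sqrt (c%:R * p) / q ->
  0 < e -> 1 <= s -> 2 * M <= q * s -> 4 * (M + 1) <= s -> s ^+ 3 <= N%:R ->
  (2 * (M ^+ 2 + M + 1) / q + 6 * M) / e <= s ->
  gaussian_ratio_on (minority_last_pmf N m c) mu s M e.
Proof.
move=> p01 qE mE c0 cNm muE sE e0 s1 Ms Ms' sN se y.
set t := standardize mu s y => tM.
have /andP[p2 p1] := p01; have p0 : 0 < p by lra.
have q0 : 0 < q by lra.
have s0 : 0 < s by lra.
have qs2 : q * s ^+ 2 = c%:R * p / q.
  rewrite sE exprMn sqr_sqrtr ?mulr_ge0 ?(ltW p0)// exprVn.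
  by field; rewrite gt_eqF.
have [X0 D0 E0] :=
  negative_hypergeometric_ratio_expansion p01 qE tM e0 s1 Ms Ms' sN se.
have yE : y%:R = mu + t * s by rewrite /t /standardize divfK ?gt_eqF// addrC subrK.
have draws : (2 * c + y)%:R = q * s ^+ 2 / p + t * s :> R.
  rewrite natrD natrM yE qs2 muE qE; field.
  by rewrite -qE !gt_eqF.
have majority : (c + y).+1%:R = q * s ^+ 2 + t * s + 1 :> R.
  rewrite -natr1 natrD yE qs2 muE qE; field.
  by rewrite -qE gt_eqF.
have cym : (c + y < m)%N.
  rewrite -(ltr_nat R) -subr_gt0; apply: lt_le_trans E0 _.
  by rewrite -mE; have := majority; rewrite -natr1; lra.
have mN : (m <= N)%N.
  by rewrite -(ler_nat R) mE ler_piMr// ltW.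
have cyN : (2 * c + y <= N)%N by move: cNm cym mN; clear; lia.
have left_m : (m - c - y)%:R = N%:R * p - q * s ^+ 2 - t * s.
  by rewrite -subnDA natrB 1?ltnW// -mE; have := majority; rewrite -natr1; lra.
have left_N : (N - 2 * c - y)%:R = N%:R - q * s ^+ 2 / p - t * s.
  by rewrite -subnDA natrB// draws opprD addrA.
have a0 : 0 < minority_last_pmf N m c y :> R.
  by apply: minority_last_pmf_gt0 => //; move: cNm cym mN; clear; lia.
split=> //; rewrite minority_last_pmfS// mulfK ?gt_eqF//.
by rewrite /minority_last_ratio draws majority left_m left_N.
Qed.

(** * The limit theorem *)

Section natural_random_variable.
Context d (T : measurableType d) (R : realType) (P : probability T R).
Variables (Y : {RV P >-> nat}) (f : nat -> R).
Hypothesis Yf : forall y, P (Y @^-1` [set y]) = (f y)%:E.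

Let measurable_preimage (A : set nat) : measurable (Y @^-1` A).
Proof. by rewrite -[_ @^-1` _]setTI; exact: measurable_funP. Qed.

Lemma probability_lt_nat n :
  P (Y @^-1` [set y | (y < n)%N]) = (\sum_(0 <= y < n) f y)%:E.
Proof.
elim: n => [|n IH].
  by rewrite big_geq// [X in P X](_ : _ = set0) ?measure0//; apply/seteqP; split.
rewrite big_nat_recr//= EFinD -IH -Yf -measureU//; last first.
- by apply/seteqP; split=> w //= []; lia.
- by congr (P _); apply/seteqP; split=> w /=; [|case]; lia.
Qed.

(** By continuity from below: the events [Y < k] increase to the whole space,
    while their probabilities are constant from [L] on. *)
Lemma pmf_sum1 L n : (forall y, (L <= y)%N -> f y = 0) -> (L <= n)%N ->
  \sum_(0 <= y < n) f y = 1.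
Proof.
move=> f0 Ln.
have : P (Y @^-1` [set y | (y < k)%N]) @[k --> \oo] --> P setT.
  have <- : \bigcup_k (Y @^-1` [set y | (y < k)%N]) = setT.
    by rewrite -subTset => w _; exists (Y w).+1 => /=.
  apply: nondecreasing_cvg_mu => //; first exact: bigcup_measurable.
  move=> i j ij; apply/subsetPset => w /= /leq_trans; exact.
rewrite probability_setT => cvg1.
suff : P (Y @^-1` [set y | (y < k)%N]) @[k --> \oo] --> (\sum_(0 <= y < n) f y)%:E.
  by move=> cvgf; apply: EFin_inj; rewrite -(cvg_unique _ cvg1 cvgf).
apply: cvg_near_cst; exists n => // k /= nk.
rewrite probability_lt_nat (big_cat_nat (leq0n n) nk)//=.
rewrite [X in _ + X]big1_seq ?addr0//.
move=> y; rewrite mem_index_iota => /andP[_ /andP[ny _]].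
by rewrite f0// (leq_trans Ln).
Qed.

End natural_random_variable.

Theorem lemma4 (R : realType) (p q : R) (hp : 1 / 2 < p < 1) (hq : q = 1 - p)
    (N m c : nat -> nat)
    (N_gt0 : forall k, (0 < N k)%N) (m_gt0 : forall k, (0 < m k)%N)
    (c_gt0 : forall k, (0 < c k)%N)
    (N_oo : N k @[k --> \oo] --> \oo)
    (mE : forall k, (m k)%:R = (N k)%:R * p)
    (c_sqrtN : (c k)%:R / Num.sqrt ((N k)%:R : R) @[k --> \oo] --> (1 : R))
    (c_le_m : forall k, (c k <= m k)%N)
    (c_le_Nm : forall k, (c k <= N k - m k)%N)
    (d : nat -> measure_display) (T : forall k, measurableType (d k))
    (P : forall k, probability (T k) R) (Y : forall k, {RV (P k) >-> nat})
    (Y_law : forall k,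
       has_max_neg_hypergeometric_distribution (P k) (Y k) (N k) (m k) (c k))
    (mu sigma : nat -> R)
    (muE : forall k, mu k = (c k)%:R * (p - q) / q)
    (sigmaE : forall k, sigma k = Num.sqrt ((c k)%:R * p) / q) :
  cvg_in_distribution P (fun k => standardize (mu k) (sigma k) \o Y k)
    (normal_prob 0 1).
Proof.
have /andP[p2 p1] := hp; have p0 : 0 < p by lra.
have q0 : 0 < q by lra.
have q1 : q < 1 / 2 by lra.
have m_le_N k : (m k <= N k)%N by rewrite -(ler_nat R) mE ler_piMr// ltW.
have cmN k : (c k <= m k <= N k)%N by rewrite c_le_m m_le_N.
have sigma_ge0 k : 0 <= sigma k by rewrite sigmaE divr_ge0 ?sqrtr_ge0// ltW.
have sigma2 k : sigma k ^+ 2 = (c k)%:R * p / q ^+ 2.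
  by rewrite sigmaE exprMn sqr_sqrtr ?mulr_ge0 ?(ltW p0)// exprVn.
(* As [q < 1 / 2 < p], the factor [p / q ^ 2] is at least 1. *)
have c_sigma2 k : (c k)%:R <= sigma k ^+ 2.
  rewrite sigma2 -mulrA ler_peMr// ler_pdivlMr ?exprn_gt0// mul1r.
  rewrite expr2; apply: (@le_trans _ _ (1 * q)); last lra.
  by rewrite ler_pM2r//; lra.
have sqrtN_oo (A : R) : \forall k \near \oo, A <= Num.sqrt ((N k)%:R : R).
  near=> k; apply: le_trans (ler_norm A) _; rewrite -sqrtr_sqr ler_wsqrtr//.
  apply: le_trans (ltW (truncnS_gt (A ^+ 2))) _; rewrite ler_nat.
  by near: k; move/cvgnyPge : N_oo; apply.
have c_near : \forall k \near \oo, 1 / 2 * Num.sqrt ((N k)%:R : R) <= (c k)%:R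
    /\ (c k)%:R <= 2 * Num.sqrt ((N k)%:R : R).
  have half_gt0 : 0 < 1 / 2 :> R by lra.
  move/cvgrPdist_le : c_sqrtN => /(_ _ half_gt0); apply: filterS => k.
  have sN0 : 0 < Num.sqrt ((N k)%:R : R) by rewrite sqrtr_gt0 ltr0n.
  rewrite ler_norml => /andP[h1 h2].
  by split; [rewrite -ler_pdivlMr// | rewrite -ler_pdivrMr//]; lra.
have c_oo (A : R) : \forall k \near \oo, A <= (c k)%:R.
  apply: filterS2 c_near (sqrtN_oo (2 * A)) => k [h1 _] h2; lra.
have sigma_oo : sigma k @[k --> \oo] --> +oo.
  apply/cvgryPge => A; apply: filterS (c_oo (A ^+ 2)) => k cA.
  apply: le_trans (ler_norm A) _; rewrite -ler_sqr ?nnegrE// real_normK ?num_real//.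
  exact: le_trans (c_sigma2 k).
have sigma_large (A : R) : \forall k \near \oo, A <= sigma k.
  by move/cvgryPge : sigma_oo; apply.
(* [sigma ^ 4] is of order [c ^ 2], hence of order [N]. *)
have sigma3_le_N : \forall k \near \oo, sigma k ^+ 3 <= (N k)%:R.
  apply: filterS3 c_near (sigma_large (4 / q ^+ 4)) (sigma_large 1) => k [_ cN] s4 s1.
  have q40 : 0 < 4 / q ^+ 4 by rewrite divr_gt0// exprn_gt0.
  rewrite -(ler_pM2r q40); apply: (@le_trans _ _ (sigma k ^+ 4)).
    by rewrite [leRHS]exprSr ler_wpM2l// exprn_ge0.
  have -> : sigma k ^+ 4 = (c k)%:R ^+ 2 * p ^+ 2 / q ^+ 4.
    rewrite -[4%N]/(2 * 2)%N exprM sigma2 !exprMn exprVn -exprM.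
    by [].
  rewrite [leRHS]mulrA ler_pM2r ?invr_gt0 ?exprn_gt0//.
  apply: (@le_trans _ _ ((c k)%:R ^+ 2 * 1)).
    by rewrite ler_wpM2l ?sqr_ge0// expr_le1// ltW.
  rewrite mulr1 (_ : _ * 4 = (2 * Num.sqrt ((N k)%:R : R)) ^+ 2).
    by rewrite ler_sqr ?nnegrE// mulr_ge0 ?sqrtr_ge0.
  by rewrite exprMn sqr_sqrtr// mulrC; congr (_ * _); lra.
have mu_large (M : R) : \forall k \near \oo, sigma k * M <= mu k.
  have pq : 0 < q * (p - q) / p by rewrite divr_gt0// mulr_gt0//; lra.
  apply: filterS (sigma_large (M / (q * (p - q) / p))) => k.
  rewrite ler_pdivrMr// => sM.
  have -> : mu k = sigma k * (sigma k * (q * (p - q) / p)).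
    rewrite mulrA -expr2 sigma2 muE; field.
    by rewrite !gt_eqF.
  by rewrite ler_wpM2l.
(* Subtracting [c] from both terms of the fraction [(N - m) / m = q / p], which
   is below 1, lowers it; hence [rhom] below. *)
pose rho := q / p.
have rho0 : 0 <= rho by rewrite divr_ge0// ltW.
have rho1 : rho < 1 by rewrite ltr_pdivrMr// mul1r; lra.
have rho01 : 0 <= rho <= 1 by rewrite rho0 ltW.
have rhom k : (N k - m k - c k)%:R <= rho * (m k - c k)%:R :> R.
  rewrite !natrB// mE mulrBr.
  have -> : rho * ((N k)%:R * p) = (N k)%:R * q.
    by rewrite /rho; field; rewrite gt_eqF.
  have : rho * (c k)%:R <= (c k)%:R by rewrite ler_piMl// ltW.
  by rewrite hq; lra.
pose a k := @minority_last_pmf R (N k) (m k) (c k).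
pose f k := max_neg_hypergeometric_pmf R (N k) (m k) (c k).
have af k i : a k i <= f k i <= (1 + rho ^+ i) * a k i.
  exact: max_neg_hypergeometric_pmf_bounds.
have a0 k i : 0 <= a k i by exact: minority_last_pmf_ge0.
have f_sum k n : ((maxn (m k - c k) (N k - m k - c k)).+1 <= n)%N ->
    \sum_(0 <= i < n) f k i = 1.
  apply: (pmf_sum1 (Y_law k)) => y.
  by rewrite /f /max_neg_hypergeometric_pmf ltnNge => /negbTE ->.
have limit := @discrete_normal_limit R a f mu sigma _ a0 _ _ f_sum sigma_oo mu_large.
move=> x _.
have {}limit : \sum_(0 <= i < count_standardize_le (mu k) (sigma k) x) f k i
    @[k --> \oo] --> std_normal_cdf x.
  apply: limit.
  - by move=> k i j; exact: minority_last_pmf_log_concave.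
  - move=> k i; have /andP[-> /le_trans ->]// := af k i.
    rewrite ler_wpM2r//; have : rho ^+ i <= 1 by rewrite exprn_ile1// ltW.
    lra.
  - move=> M e e0.
    have rho_small : \forall n \near \oo, rho ^+ n <= e.
      have := @cvg_expr R rho; rewrite ger0_norm// => /(_ rho1).
      move=> /cvgrPdist_le/(_ _ e0); apply: filterS => n.
      by rewrite sub0r normrN ger0_norm// exprn_ge0.
    have [n0 _ n0P] := rho_small.
    apply: filterS2 (sigma_large (n0%:R + 1)) (mu_large (M + 1)) => k s1 sM i.
    rewrite ler_norml => /andP[Mi _].
    have s0 : 0 < sigma k by apply: lt_le_trans s1; rewrite ltr_wpDl.
    have n0i : (n0 <= i)%N.
      rewrite -(ler_nat R); move: Mi; rewrite /standardize ler_pdivlMr//.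
      by lra.
    have /andP[_ /le_trans] := af k i; apply.
    by rewrite ler_wpM2r// lerD2l; exact: n0P.
  - move=> M0 e e0; pose M := Num.max M0 0.
    have M00 : 0 <= M by rewrite le_max lexx orbT.
    apply: filterS3 sigma3_le_N (sigma_large (2 * M / q + 4 * (M + 1)))
      (sigma_large ((2 * (M ^+ 2 + M + 1) / q + 6 * M) / e)) => k s3 sM se.
    have Mq : 0 <= 2 * M / q by rewrite divr_ge0 ?mulr_ge0// ltW.
    have : gaussian_ratio_on (a k) (mu k) (sigma k) M e.
      apply: (minority_last_pmf_gaussian_ratio hp hq (mE k)) => //.
      + lra.
      + by rewrite [leRHS]mulrC -ler_pdivrMr//; lra.
      + lra.
    by move=> ratio i iM; apply: ratio; rewrite le_max iM.
have cdfE : \forall k \near \oo,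
    cdf (standardize (mu k) (sigma k) \o Y k : {RV (P k) >-> R}) x =
    (\sum_(0 <= i < count_standardize_le (mu k) (sigma k) x) f k i)%:E.
  apply: filterS2 (sigma_large 1) (mu_large (- x)) => k s1 mux.
  have s0 : 0 < sigma k := lt_le_trans ltr01 s1.
  rewrite -(probability_lt_nat (Y_law k)); congr (P k _).
  apply/seteqP; split=> w /=; rewrite in_itv/= lt_count_standardize//; lra.
have Phi_x := EFin_std_normal_cdf x.
rewrite [X in _ --> X]Phi_x; apply/fine_cvgP; split.
  by apply: filterS cdfE => k ->.
apply: cvg_trans limit; apply: near_eq_cvg.
by apply: filterS cdfE => k /= ->.
Unshelve. all: by end_near. Qed.
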